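(* Consider the primal problem $$(\mathrm{P})\quad\begin{aligned} \text{minimize}\quad & \langle \mathbf{C},\mathbf{M}\rangle+\epsilon D(\mathbf{M})+\sum_{t\in\mathcal{V}}g_t(\mu_t)+\sum_{(t_1,t_2)\in\mathcal{E}}f_{t_1,t_2}(R_{t_1,t_2})\\ \text{subject to}\quad & P_t(\mathbf{M})=\mu_t,\ t\in\mathcal{V},\qquad P_{t_1,t_2}(\mathbf{M})=R_{t_1,t_2},\ (t_1,t_2)\in\mathcal{E}, \end{aligned}$$ over $\mathbf{M}\in\mathbb{R}_+^{N^{\mathcal{T}}}$, $\mu_t\in\mathbb{R}^N$ ($t\in\mathcal{V}$), $R_{t_1,t_2}\in\mathbb{R}^{N\times N}$ ($(t_1,t_2)\in\mathcal{E}$). The Lagrangian dual of $(\mathrm{P})$ obtained by relaxing the marginal and bimarginal constraints with multipliers $\lambda_t\in\mathbb{R}^N$ and $\Lambda_{t_1,t_2}\in\mathbb{R}^{N\times N}$ is, up to an additive constant (independent of the multipliers) in the objective, given by $$(\mathrm{D})\quad \sup_{\substack{\lambda_t\in\mathbb{R}^N,\ t\in\mathcal{V}\\ \Lambda_{t_1,t_2}\in\mathbb{R}^{N\times N},\ (t_1,t_2)\in\mathcal{E}}}\ -\epsilon\langle\mathbf{K},\mathbf{U}\rangle-\sum_{t\in\mathcal{V}}(g_t)^*(-\lambda_t)-\sum_{(t_1,t_2)\in\mathcal{E}}(f_{t_1,t_2})^*(-\Lambda_{t_1,t_2}),$$ where $$\mathbf{K}^{(i_1\ldots i_{\mathcal{T}})}=\exp\big(-\mathbf{C}^{(i_1\ldots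 i_{\mathcal{T}})}/\epsilon\big),\qquad \mathbf{U}^{(i_1\ldots i_{\mathcal{T}})}=\prod_{t\in\mathcal{V}}\exp\big(\lambda_t^{(i_t)}/\epsilon\big)\prod_{(t_1,t_2)\in\mathcal{E}}\exp\big(\Lambda_{t_1,t_2}^{(i_{t_1},i_{t_2})}/\epsilon\big).$$ Moreover, if there exists a nonnegative tensor $\mathbf{M}$ with $\langle \mathbf{C},\mathbf{M}\rangle<\infty$, $g_t(P_t(\mathbf{M}))<\infty$ for all $t\in\mathcal{V}$ and $f_{t_1,t_2}(P_{t_1,t_2}(\mathbf{M}))<\infty$ for all $(t_1,t_2)\in\mathcal{E}$, then the minimum in $(\mathrm{P})$ equals the supremum in $(\mathrm{D})$ up to the discarded constant. Finally, if $(\mathrm{D})$ has an optimal solution, then the optimal solution to $(\mathrm{P})$ takes the form $\mathbf{M}^\star=\mathbf{K}\odot\mathbf{U}^\star$, where, for an optimal solution $\big((\lambda_t^\star)_{t\in\mathcal{V}},(\Lambda_{t_1,t_2}^\star)_{(t_1,t_2)\in\mathcal{E}}\big)$ to $(\mathrm{D})$, $$(\mathbf{U}^\star)^{(i_1\ldots i_{\mathcal{T}})}=\prod_{t\in\mathcal{V}}\exp\big((\lambda_t^\star)^{(i_t)}/\epsilon\big)\prod_{(t_1,t_2)\in\mathcal{E}}\exp\big((\Lambda_{t_1,t_2}^\star)^{(i_{t_1},i_{t_2})}/\epsilon\big).$$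
   Context: Setting: $\mathcal{G}=(\mathcal{V},\mathcal{E})$ is a finite connected graph with $\mathcal{V}=\{1,\dots,\mathcal{T}\}$; each edge is listed in $\mathcal{E}$ as an ordered pair $(t_1,t_2)$ of vertices. $N\ge 1$ is an integer and $\epsilon>0$. $\bar{\mathbb{R}}=\mathbb{R}\cup\{\pm\infty\}$. $\mathbf{C}$ is a $\mathcal{T}$-mode tensor with $N^{\mathcal{T}}$ elements in $(-\infty,+\infty]$ of the form $\mathbf{C}^{(i_1\ldots i_{\mathcal{T}})}=\sum_{(t_1,t_2)\in\mathcal{E}}C_{t_1,t_2}^{(i_{t_1},i_{t_2})}$ for $N\times N$ matrices $C_{t_1,t_2}$. The functions $g_t:\mathbb{R}^N\to\bar{\mathbb{R}}$ and $f_{t_1,t_2}:\mathbb{R}^{N\times N}\to\bar{\mathbb{R}}$ are proper, convex and lower-semicontinuous. Notation, with the conventions $0\cdot(\pm\infty)=0$ and $\exp(-\infty)=0$: $\langle\mathbf{C},\mathbf{M}\rangle=\sum_{i_1,\ldots,i_{\mathcal{T}}}\mathbf{C}^{(i_1\ldots i_{\mathcal{T}})}\mathbf{M}^{(i_1\ldots i_{\mathcal{T}})}$; $D(\mathbf{M})=\sum_{i_1,\ldots,i_{\mathcal{T}}}\big(\mathbf{M}^{(i_1\ldots i_{\mathcal{T}})}\log \mathbf{M}^{(i_1\ldots i_{\mathcal{T}})}-\mathbf{M}^{(i_1\ldots i_{\mathcal{T}})}+1\big)$; $\odot$ is the elementwise product. The marginal $P_t(\mathbf{M})\in\mathbb{R}^N$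 has elements $(P_t(\mathbf{M}))^{(i_t)}$ obtained by summing $\mathbf{M}^{(i_1\ldots i_{\mathcal{T}})}$ over all indices except $i_t$; the bimarginal $P_{t_1,t_2}(\mathbf{M})\in\mathbb{R}^{N\times N}$ has elements obtained by summing over all indices except $i_{t_1},i_{t_2}$. The Fenchel conjugate is $h^*(x^* )=\sup_x \langle x^*,x\rangle-h(x)$. The Lagrangian is $$L(\mathbf{M},\mu,R,\lambda,\Lambda)=\langle \mathbf{C},\mathbf{M}\rangle+\epsilon D(\mathbf{M})+\sum_{t\in\mathcal{V}}g_t(\mu_t)+\sum_{(t_1,t_2)\in\mathcal{E}}f_{t_1,t_2}(R_{t_1,t_2})+\sum_{t\in\mathcal{V}}\lambda_t^T(\mu_t-P_t(\mathbf{M}))+\sum_{(t_1,t_2)\in\mathcal{E}}\mathrm{tr}\big[\Lambda_{t_1,t_2}^T(R_{t_1,t_2}-P_{t_1,t_2}(\mathbf{M}))\big],$$ and the Lagrangian dual problem is to take the supremum over $(\lambda,\Lambda)$ of the dual function $\inf_{\mathbf{M}\ge 0,\,\mu,\,R}L(\mathbf{M},\mu,R,\lambda,\Lambda)$. *)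

(* Defs.v *)
From HB Require Import structures.
From mathcomp Require Import all_boot all_order all_algebra.
From mathcomp Require Import all_classical all_reals all_analysis.

Set Implicit Arguments.
Unset Strict Implicit.
Unset Printing Implicit Defensive.

Import Order.TTheory GRing.Theory Num.Theory.
Import numFieldNormedType.Exports.

Local Open Scope classical_set_scope.
Local Open Scope ring_scope.
Local Open Scope ereal_scope.

(* Vectors of R^N are the case n = 1 of what follows: <x, y> is then x^T y. *)
Definition mxdot (R : realType) (m n : nat) (x y : 'M[R]_(m, n)) : R :=
  (\tr (x^T *m y))%R.

Definition proper_fun (R : realType) (m n : nat) (h : 'M[R]_(m, n) -> \bar R) :=
  (forall x, -oo < h x) /\ (exists x, h x < +oo).

(* Only applied to functions that do not take the value -oo, so that the
   right-hand side is never of the form oo - oo. *)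
Definition convex_efun (R : realType) (m n : nat)
    (h : 'M[R]_(m, n) -> \bar R) :=
  forall (x y : 'M[R]_(m, n)) (s : R), (0 <= s <= 1)%R ->
    h (s *: x + (1 - s) *: y)%R <= s%:E * h x + (1 - s)%:E * h y.

Definition proper_convex_lsc (R : realType) (m n : nat)
    (h : 'M[R]_(m, n) -> \bar R) :=
  [/\ proper_fun h, convex_efun h & lower_semicontinuous h].

Definition fenchel_conjugate (R : realType) (m n : nat)
    (h : 'M[R]_(m, n) -> \bar R) (y : 'M[R]_(m, n)) : \bar R :=
  ereal_sup [set (mxdot y x)%:E - h x | x in [set: 'M[R]_(m, n)]].

(* Vertices are 'I_T; E lists every edge as an ordered pair, whose orientation
   is irrelevant for connectedness. *)
Definition edge (T : nat) (E : {set 'I_T * 'I_T}) :=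
  {e : 'I_T * 'I_T | e \in E}.

Definition graph_connected (T : nat) (E : {set 'I_T * 'I_T}) :=
  forall s t : 'I_T,
    connect (fun u v : 'I_T => ((u, v) \in E) || ((v, u) \in E)) s t.

Definition multi_index (T N : nat) := {ffun 'I_T -> 'I_N}.

Definition tensor (T N : nat) (K : Type) := multi_index T N -> K.

Section tensor_problem.
Context {R : realType} {T N : nat} {E : {set 'I_T * 'I_T}}.
Implicit Types (M : tensor T N R) (i : multi_index T N) (e : edge E).
Implicit Types (mu lam : 'I_T -> 'cV[R]_N) (Rm Lam : edge E -> 'M[R]_N).

Definition cost_tensor (Cm : edge E -> 'M[\bar R]_N) : tensor T N (\bar R) :=
  fun i => \sum_(e : edge E) Cm e (i (val e).1) (i (val e).2).

Definition nonneg_tensor M := forall i, (0 <= M i)%R.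

(* 0 * +oo = 0 in \bar R. *)
Definition cost (C : tensor T N (\bar R)) M : \bar R :=
  \sum_(i : multi_index T N) C i * (M i)%:E.

(* ln 0 = 0 in the library, hence 0 log 0 = 0. *)
Definition entropy M : R :=
  (\sum_(i : multi_index T N) (M i * ln (M i) - M i + 1))%R.

Definition marginal (t : 'I_T) M : 'cV[R]_N :=
  (\col_k \sum_(i : multi_index T N | i t == k) M i)%R.

Definition bimarginal e M : 'M[R]_N :=
  (\matrix_(k, l)
     \sum_(i : multi_index T N | (i (val e).1 == k) && (i (val e).2 == l))
       M i)%R.

Variables (eps : R) (C : tensor T N (\bar R)).
Variables (g : 'I_T -> 'cV[R]_N -> \bar R) (f : edge E -> 'M[R]_N -> \bar R).

Definition primal_objective M mu Rm : \bar R :=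
  cost C M + (eps * entropy M)%:E
  + \sum_(t : 'I_T) g t (mu t) + \sum_(e : edge E) f e (Rm e).

Definition primal_feasible M mu Rm :=
  [/\ nonneg_tensor M,
      forall t, marginal t M = mu t &
      forall e, bimarginal e M = Rm e].

Definition primal_optimal M mu Rm :=
  [/\ primal_feasible M mu Rm,
      primal_objective M mu Rm < +oo &
      forall M' mu' Rm', primal_feasible M' mu' Rm' ->
        primal_objective M mu Rm <= primal_objective M' mu' Rm'].

Definition lagrangian M mu Rm lam Lam : \bar R :=
  primal_objective M mu Rm
  + (\sum_(t : 'I_T) mxdot (lam t) (mu t - marginal t M)%R)%:E
  + (\sum_(e : edge E) mxdot (Lam e) (Rm e - bimarginal e M)%R)%:E.

Definition dual_function lam Lam : \bar R :=
  ereal_inf [set v | exists M mu Rm,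
    nonneg_tensor M /\ v = lagrangian M mu Rm lam Lam].

(* Real-valued: C never takes the value -oo, so that the exponential of
   - C / eps is finite, with exp(-oo) = 0. *)
Definition kernel_tensor : tensor T N R :=
  fun i => fine (expeR (- (C i * (eps^-1)%:E))).

Definition scaling_tensor lam Lam : tensor T N R :=
  fun i => (\prod_(t : 'I_T) expR (lam t (i t) 0 / eps)
    * \prod_(e : edge E) expR (Lam e (i (val e).1) (i (val e).2) / eps))%R.

Definition tensor_mul M M' : tensor T N R := fun i => (M i * M' i)%R.

Definition tensor_dot M M' : R :=
  (\sum_(i : multi_index T N) M i * M' i)%R.

Definition dual_objective lam Lam : \bar R :=
  (- (eps * tensor_dot kernel_tensor (scaling_tensor lam Lam)))%:E
  - \sum_(t : 'I_T) fenchel_conjugate (g t) (- lam t)%R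
  - \sum_(e : edge E) fenchel_conjugate (f e) (- Lam e)%R.

Definition dual_value : \bar R :=
  ereal_sup [set v | exists lam Lam, v = dual_objective lam Lam].

Definition dual_optimal lam Lam :=
  forall lam' Lam', dual_objective lam' Lam' <= dual_objective lam Lam.

End tensor_problem.

(* Main.v *)
Require Import Defs.
From mathcomp Require Import all_boot all_order all_algebra.
From mathcomp Require Import all_classical all_reals all_analysis.
From mathcomp Require Import ring lra.
Import Order.TTheory GRing.Theory Num.Theory.
Import numFieldNormedType.Exports.

Set Implicit Arguments.
Unset Strict Implicit.
Unset Printing Implicit Defensive.

Local Open Scope classical_set_scope.
Local Open Scope ring_scope.
Local Open Scope ereal_scope.

(* Strong duality is obtained by a quadratic penalty. Put the unknowns in one
   vector x = (M, mu, R), let h be the primal objective (+oo unless M >= 0) and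
   let r(x) be the violation of the marginal constraints. The entropy is
   superlinear in M and a convex lsc function decreases at most linearly, so
   the sublevel sets of h + |r|^2 are compact and h + k |r|^2 has a minimiser
   x_k; by convexity, 2 k r(x_k) is a multiplier whose dual value is
   h(x_k) + 2 k |r(x_k)|^2. If the dual is bounded by d, the nonempty compact
   sets {h + k |r|^2 <= d} are nested, and a common point is feasible with
   h <= d. The dual function is explicit because the Lagrangian is separable,
   and each scalar problem in M has the unique minimiser K U, which
   gives the form of the optimal M. *)

(** * Lower semicontinuity and convexity of extended-valued functions *)

Lemma lsc_closed_sublevel (R : realType) (X : topologicalType)
    (f : X -> \bar R) (a : R) :
  lower_semicontinuous f -> closed [set x | f x <= a%:E].
Proof.
move=> /lower_semicontinuousP /(_ a) fo.
rewrite (_ : [set _ | _] = ~` [set x | a%:E < f x]); first exact: open_closedC.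
apply/seteqP; split => x /=.
  by move=> h /(le_lt_trans h); rewrite ltxx.
by rewrite leNgt => /negP.
Qed.

Lemma lscD (R : realType) (X : topologicalType) (f g : X -> \bar R) :
  (forall x, -oo < f x) -> (forall x, -oo < g x) ->
  lower_semicontinuous f -> lower_semicontinuous g ->
  lower_semicontinuous (fun x => f x + g x).
Proof.
move=> fN gN lf lg x a afg.
(* Distribute the level [a] over the two summands: if both are finite the slack is halved, otherwise
   the infinite one absorbs it. *)
have [b [c [bf cg abc]]] : exists b c : R,
    [/\ b%:E < f x, c%:E < g x & (a <= b + c)%R].
  move: (fN x) (gN x) afg; case: (f x) => [u| |] //; case: (g x) => [v| |] // _ _.
  - rewrite -EFinD lte_fin => h; exists (u - (u + v - a) / 2)%R, (v - (u + v - a) / 2)%R.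
    by split; rewrite ?lte_fin; lra.
  - by move=> _; exists (u - 1)%R, (a - u + 1)%R; split; rewrite ?lte_fin ?ltry//; lra.
  - by move=> _; exists (a - v + 1)%R, (v - 1)%R; split; rewrite ?lte_fin ?ltry//; lra.
  - by move=> _; exists a, 0%R; split; rewrite ?ltry//; lra.
have [V Vx fV] := lf x b bf; have [W Wx gW] := lg x c cg.
exists (V `&` W); first exact: filterI.
move=> y [/fV fy /gW gy].
by rewrite (le_lt_trans _ (lteD fy gy))// -EFinD lee_fin.
Qed.

Lemma esum_gtNy (R : realType) (I : Type) (s : seq I) (f : I -> \bar R) :
  (forall i, -oo < f i) -> -oo < \sum_(i <- s) f i.
Proof.
move=> fN; elim/big_ind : _ => [|x y|//]; first exact: ltNyr.
by case: x => [x| |]; case: y => [y| |] // _ _; rewrite -EFinD ltNyr.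
Qed.

Lemma lsc_sum (R : realType) (X : topologicalType) (I : Type) (s : seq I)
    (f : I -> X -> \bar R) :
  (forall i x, -oo < f i x) -> (forall i, lower_semicontinuous (f i)) ->
  lower_semicontinuous (fun x => \sum_(i <- s) f i x).
Proof.
move=> fN lf; elim: s => [x a|i s IH].
  by rewrite big_nil => a0; exists setT => [|y _]; [exact: filterT|rewrite big_nil].
under eq_fun do rewrite big_cons.
by apply: lscD => // x; exact: esum_gtNy.
Qed.

Lemma continuous_lsc (R : realType) (X : topologicalType) (r : X -> R) :
  continuous r -> lower_semicontinuous (fun x => (r x)%:E).
Proof.
move=> cr x a; rewrite lte_fin => ar.
exists [set y | (a < r y)%R] => [|y]; last by rewrite /= lte_fin.
exact: (cr x [set z | (a < z)%R] (lt_nbhsr ar)).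
Qed.

Lemma convex_efunD (R : realType) (m n : nat) (f g : 'M[R]_(m, n) -> \bar R) :
  (forall x, -oo < f x) -> (forall x, -oo < g x) ->
  convex_efun f -> convex_efun g -> convex_efun (fun x => f x + g x).
Proof.
move=> fN gN cf cg x y s s01.
have d z : f z +? g z.
  by move: (fN z) (gN z); case: (f z) => [?| |]; case: (g z) => [?| |].
rewrite !muleDr// addeACA; apply: leeD; [exact: cf|exact: cg].
Qed.

Lemma convex_efun_sum (R : realType) (m n : nat) (I : Type) (s : seq I)
    (f : I -> 'M[R]_(m, n) -> \bar R) :
  (forall i x, -oo < f i x) -> (forall i, convex_efun (f i)) ->
  convex_efun (fun x => \sum_(i <- s) f i x).
Proof.
move=> fN cf; elim: s => [|i s IH].
  by move=> x y a _; rewrite !big_nil !mule0 adde0.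
have := convex_efunD (fN i) (fun x => esum_gtNy s (fN^~ x)) (cf i) IH.
by rewrite (_ : (fun x => f i x + _) = fun x => \sum_(j <- i :: s) f j x)//;
  apply/funext => x; rewrite big_cons.
Qed.

(** Cantor intersection: points chosen in the sets cluster in a compact box, and since each closed
    set contains a tail of the sequence, it contains the cluster point. *)
Lemma nested_closed_cap (R : realType) (n : nat) (S : nat -> set 'rV[R]_n)
    (b : R) :
  (forall k, closed (S k)) -> (forall k, S k.+1 `<=` S k) ->
  (forall x, S 0%N x -> forall i, (`|x 0 i| <= b)%R) ->
  (forall k, S k !=set0) -> exists x, forall k, S k x.
Proof.
move=> cS nS bS neS.
have [u uS] := choice neS.
have mono k l : (k <= l)%N -> S l `<=` S k.
  move=> /subnK <-; elim: (l - k)%N => [//|j IH]; rewrite addSn.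
  exact: (subset_trans (nS _)).
have cB : compact [set v : 'rV[R]_n | forall i, `[(- b)%R, b]%classic (v 0%R i)].
  apply: (@rV_compact _ _ (fun=> `[(- b)%R, b]%classic)) => _.
  exact: segment_compact.
have [|p [_ clp]] := cB (u @ \oo) _.
  exists 0%N => // k _ i /=; rewrite in_itv /= -ler_norml; apply: bS.
  exact: (mono 0%N k).
exists p => k; apply: cS => B Bp; apply: clp => //.
by exists k => // l /= kl; exact: mono (uS l).
Qed.

(** Sublevel sets at levels decreasing to the infimum are nested, closed, bounded and nonempty; any
    common point is a minimiser. *)
Lemma lsc_min (R : realType) (n : nat) (phi : 'rV[R]_n -> \bar R) :
  lower_semicontinuous phi -> (forall x, -oo < phi x) ->
  (exists x, phi x < +oo) ->
  (forall a : R, exists b : R, forall x, phi x <= a%:E ->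
    forall i, (`|x 0 i| <= b)%R) ->
  exists x, phi x < +oo /\ forall y, phi x <= phi y.
Proof.
move=> lphi phiN [x0 x0y] coer; pose m := ereal_inf (range phi).
have mlb y : m <= phi y by apply: ereal_inf_lbound; exists y.
have my : m < +oo by exact: le_lt_trans (mlb x0) x0y.
(* The infimum [m] is not yet known to be finite, so the levels are [m + 1/(k+1)] if it is real and
   [-k] if it is [-oo]. *)
have [a [adec am ma]] : exists a : nat -> R, [/\ forall k, (a k.+1 <= a k)%R,
    forall k, m < (a k)%:E & forall v, (forall k, v <= (a k)%:E) -> v <= m].
  case: m my {mlb} => [r _| //|_].
  - exists (fun k => r + k.+1%:R^-1)%R; split => [k|k|v hv].
    + by rewrite lerD2l lef_pV2 ?posrE// ler_nat.
    + by rewrite lte_fin ltrDl invr_gt0.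
    + apply/lee_addgt0Pr => e e0.
      have [k ke] : exists k : nat, (k.+1%:R^-1 < e)%R.
        exists (Num.truncn e^-1); rewrite invf_plt ?posrE//.
        exact: truncnS_gt.
      by apply: le_trans (hv k) _; rewrite -EFinD lee_fin lerD2l ltW.
  - exists (fun k => - k%:R)%R; split => [k|k|v hv]; rewrite ?ltNyr//.
      by rewrite lerN2 ler_nat.
    case: v hv => [v| |] // hv; last by have := hv 0%N.
    have := hv (Num.truncn (- v)).+1; rewrite lee_fin => h.
    exfalso; have := truncnS_gt (- v)%R; lra.
have [b hb] := coer (a 0%N).
have [||||x hx] := @nested_closed_cap R n (fun k => [set x | phi x <= (a k)%:E]) b.
- by move=> k; exact: lsc_closed_sublevel.
- by move=> k x /= /le_trans; apply; rewrite lee_fin.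
- exact: hb.
- by move=> k; have [_ [x _ <-] /ltW] := ereal_inf_lt (am k); exists x.
- exists x; split; first exact: le_lt_trans (ma _ hx) my.
  by move=> y; exact: le_trans (ma _ hx) (mlb y).
Qed.

(** * Duality for affine constraints by a quadratic penalty *)

Section penalty.
Variables (R : realType) (n : nat) (J : finType).
Variables (h : 'rV[R]_n -> \bar R) (r : J -> 'rV[R]_n -> R).
Hypotheses (h_gtNy : forall x, -oo < h x) (h_lty : exists x, h x < +oo).
Hypotheses (h_convex : convex_efun h) (h_lsc : lower_semicontinuous h).
Hypothesis r_cont : forall j, continuous (r j).
Hypothesis r_affine : forall j x y s,
  r j (s *: x + (1 - s) *: y)%R = (s * r j x + (1 - s) * r j y)%R.

Let sqn x := (\sum_j r j x ^+ 2)%R.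
(** The weight is [k + 1], so that [pen 0] is exactly the function assumed coercive below; larger
    weights inherit its bounds. *)
Let pen (k : nat) x := h x + (k.+1%:R * sqn x)%:E.

Hypothesis coercive : forall a : R, exists b : R,
  forall x, h x + (\sum_j r j x ^+ 2)%:E <= a%:E -> forall i, (`|x 0 i| <= b)%R.

Let sqn_ge0 x : (0 <= sqn x)%R.
Proof. by apply: sumr_ge0 => j _; exact: sqr_ge0. Qed.

Let pen_mono k l x : (k <= l)%N -> pen k x <= pen l x.
Proof. by move=> kl; rewrite leeD2l// lee_fin ler_wpM2r// ler_nat. Qed.

Let sqn_cont : continuous sqn.
Proof.
apply: (@continuous_big R J +%R 0%R xpredT) => [|j _ x]; first exact: add_continuous.
exact: (cvgM (@r_cont j x) (@r_cont j x)).
Qed.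

Let pen_lsc k : lower_semicontinuous (pen k).
Proof.
apply: lscD => // [x|]; first exact: ltNyr.
apply: continuous_lsc => x; exact: (cvgMl_tmp (@sqn_cont x)).
Qed.

Let pen_bounded k (a : R) : exists b : R, forall x, pen k x <= a%:E ->
  forall i, (`|x 0 i| <= b)%R.
Proof.
have [b hb] := coercive a; exists b => x xa; apply: hb.
by apply: le_trans xa; have := @pen_mono 0 k x isT; rewrite /pen mul1r.
Qed.

(* First-order optimality: linearising the quadratic penalty at its minimiser
   turns 2 (k + 1) r(x) into a Lagrange multiplier. *)
Let penalty_multiplier k : exists x, h x < +oo /\ forall y,
  h x + (k.+1%:R * sqn x *+ 2)%:E
  <= h y + (\sum_j (2 * k.+1%:R * r j x) * r j y)%:E.
Proof.
have [||x [xy xmin]] := lsc_min (@pen_lsc k) _ _ (@pen_bounded k).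
- move=> x; rewrite /pen; move: (h_gtNy x); case: (h x) => //= u _.
  by rewrite -EFinD ltNyr.
- have [x hx] := h_lty; exists x; rewrite /pen.
  by move: hx; case: (h x) => //= u _; rewrite -EFinD ltry.
have hxy : h x < +oo by move: xy; rewrite /pen; case: (h x) => [u _| |] //; exact: ltry.
exists x; split => // y.
have [u hx] : exists u, h x = u%:E.
  by move: hxy (h_gtNy x); case: (h x) => [u| |] //; exists u.
rewrite hx; move: (h_gtNy y).
case hy : (h y) => [v| |] // _; last by rewrite addye// leey.
rewrite -!EFinD lee_fin.
pose B := (\sum_j r j x * (r j y - r j x))%R.
pose Q := (\sum_j (r j y - r j x) ^+ 2)%R.
have Q0 : (0 <= Q)%R by apply: sumr_ge0 => j _; exact: sqr_ge0.
(* Compare the minimiser [x] with the point at parameter [s] on the segment from [x] to [y], use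
   convexity of [h], and divide by [s]; only the quadratic term keeps a factor [s]. *)
have step (s : R) : (0 < s <= 1)%R ->
    (u <= v + k.+1%:R * (B *+ 2) + s * (k.+1%:R * Q))%R.
  move=> /andP[s0 s1].
  have := xmin (s *: y + (1 - s) *: x)%R.
  have s01 : (0 <= s <= 1)%R by rewrite (ltW s0).
  have hc := h_convex y x s01.
  move=> /le_trans => /(_ _ (leeD hc (lexx _))).
  rewrite /pen hx hy -!EFinM -!EFinD lee_fin.
  have -> : sqn (s *: y + (1 - s) *: x)%R = (sqn x + s * (B *+ 2) + s ^+ 2 * Q)%R.
    rewrite /sqn /B /Q -mulr_natr !mulr_suml !mulr_sumr -!big_split /=.
    by apply: eq_bigr => j _; rewrite r_affine; ring.
  move: (sqn x) (k.+1%:R)%R => q c H.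
  have : (s * u <= s * (v + c * (B *+ 2) + s * (c * Q)))%R by lra.
  by rewrite ler_pM2l.
have lim : (u <= v + k.+1%:R * (B *+ 2))%R.
  apply/ler_addgt0Pr => e e0.
  have cQ0 : (0 <= k.+1%:R * Q)%R by rewrite mulr_ge0.
  set q := (k.+1%:R * Q)%R in step cQ0 *.
  (* In place of a limit as [s] tends to 0: this value of [s] lies in the allowed range and
     satisfies [s * q <= e]. *)
  have e1 : (0 < e / (e + q + 1) <= 1)%R.
    by rewrite divr_gt0 ?ler_pdivrMr; lra.
  apply: le_trans (step _ e1) _; rewrite lerD2l mulrAC.
  by rewrite ler_pdivrMr; nra.
have -> : (\sum_j (2 * k.+1%:R * r j x) * r j y
    = k.+1%:R * (B *+ 2) + k.+1%:R * sqn x *+ 2)%R.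
  rewrite -[(B *+ 2)%R]mulr_natr -[(_ * sqn x *+ 2)%R]mulr_natr.
  rewrite /sqn /B !mulr_suml !mulr_sumr mulr_suml -!big_split /=.
  by apply: eq_bigr => j _; ring.
lra.
Qed.

(** The multiplier read off at the minimiser of [pen 0] has a finite dual value; this later excludes
    [-oo] as the supremum of the dual. *)
Lemma dual_proper : exists (lam : J -> R) (c : R), forall x,
  c%:E <= h x + (\sum_j lam j * r j x)%:E.
Proof.
have [x [xy hx]] := penalty_multiplier 0.
exists (fun j => 2 * 1%:R * r j x)%R.
move: xy (h_gtNy x) hx; case: (h x) => [u| |] // _ _ hx.
by exists (u + 1%:R * sqn x *+ 2)%R => y; rewrite EFinD; exact: hx.
Qed.

Lemma penalty_duality (d : R) :
  (forall (lam : J -> R) (c : R),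
     (forall x, c%:E <= h x + (\sum_j lam j * r j x)%:E) -> (c <= d)%R) ->
  exists x, (forall j, r j x = 0%R) /\ h x <= d%:E.
Proof.
move=> hd.
have [b hb] := pen_bounded 0 d.
have [||||x hx] := @nested_closed_cap R n (fun k => [set x | pen k x <= d%:E]) b.
- by move=> k; exact: lsc_closed_sublevel.
- by move=> k x /=; apply: le_trans; exact: pen_mono.
- exact: hb.
(* The sublevel set contains the minimiser of [pen k]: its value is at most [h x + 2 (k + 1) sqn x],
   a dual value and hence at most [d]. *)
- move=> k; have [x [xy hx]] := penalty_multiplier k; exists x; rewrite /= /pen.
  move: xy (h_gtNy x) hx; case: (h x) => [u| |] // _ _ hx.
  rewrite -EFinD lee_fin; apply: le_trans (hd _ _ hx).
  by rewrite lerD2l mulr2n lerDl mulr_ge0.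
have {}hx k : pen k x <= d%:E by exact: hx.
have hxd : h x <= d%:E.
  by apply: le_trans (hx 0%N); rewrite /pen leeDl// lee_fin mulr_ge0.
exists x; split => //.
suff /eqP : sqn x = 0%R.
  rewrite psumr_eq0 => [/allP q0 j|j _]; last exact: sqr_ge0.
  by apply/eqP; rewrite -sqrf_eq0; exact: (q0 _ (mem_index_enum j)).
move: hxd (h_gtNy x) (hx); rewrite /pen; case: (h x) => [u| |] // _ _ {}hx.
apply/eqP; rewrite eq_le sqn_ge0 andbT leNgt; apply/negP => q0.
(* A nonzero residual would be violated by this weight, since [k + 1] exceeds [(d - u) / sqn x]. *)
have := hx (Num.truncn ((d - u) / sqn x)).
rewrite -EFinD lee_fin => h1.
have := truncnS_gt ((d - u) / sqn x)%R; rewrite ltr_pdivrMr//; lra.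
Qed.

End penalty.

(** * Suprema of affine functions *)

(* Gives convexity and lower semicontinuity of the entropic cost at once,
   without a separate limit argument at m = 0. *)
Definition sup_of_affine (R : realType) (f : R -> \bar R) :=
  forall (m a : R), a%:E < f m ->
  exists p q : R, (a < p * m + q)%R /\ forall x, (p * x + q)%:E <= f x.

Lemma sup_of_affine_lsc (R : realType) (X : topologicalType) (f : R -> \bar R)
    (u : X -> R) :
  sup_of_affine f -> continuous u -> lower_semicontinuous (f \o u).
Proof.
move=> fa cu x a /fa[p [q [apq pqf]]].
have c : continuous (fun y => p * u y + q)%R.
  by move=> y; apply: cvgD; [exact: (cvgMl_tmp (@cu y))|exact: cvg_cst].
have [V Vx hV] := continuous_lsc c (apq : a%:E < (p * u x + q)%:E).
by exists V => // y /hV /lt_le_trans; apply; exact: pqf.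
Qed.

(** If convexity failed, some affine minorant would exceed the right-hand side at the combined
    point; but there it equals the combination of its own values, each below that of [f]. *)
Lemma sup_of_affine_convex (R : realType) (m n : nat) (f : R -> \bar R)
    (u : 'M[R]_(m, n) -> R) :
  (forall z, -oo < f z) -> sup_of_affine f ->
  (forall x y s, u (s *: x + (1 - s) *: y) = s * u x + (1 - s) * u y)%R ->
  convex_efun (f \o u).
Proof.
move=> fN fa ua x y s /andP[s0 s1] /=; rewrite leNgt; apply/negP.
have t0 : (0 <= 1 - s)%R by rewrite subr_ge0.
have h z (a : R) : (0 <= a)%R -> -oo < a%:E * f z.
  move=> a0; move: (fN z); case: (f z) => [r| |] // _; first by rewrite -EFinM ltNyr.
  move: a0; rewrite le_eqVlt => /orP[/eqP <-|a0]; first by rewrite mul0e ltNyr.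
  by rewrite gt0_muley.
have : -oo < s%:E * f (u x) + (1 - s)%:E * f (u y).
  move: (h (u x) _ s0) (h (u y) _ t0).
  case: (s%:E * _) => [r| |] //; case: ((1 - s)%:E * _) => [r'| |] // _ _.
  exact: ltNyr.
case E : (s%:E * _ + _) => [w| |] // _; last by rewrite ltNge leey.
move=> /fa[p [q [wpq pqf]]].
have : (s * (p * u x + q) + (1 - s) * (p * u y + q))%:E <= w%:E.
  by rewrite -E EFinD !EFinM; apply: leeD; apply: lee_wpmul2l; rewrite ?lee_fin// ?pqf.
by rewrite lee_fin; move: wpq; rewrite ua; lra.
Qed.

(** * The scalar entropic problem *)

(** Scalar form of an entry of [kernel_tensor]. Multiplied by [expR (y / eps)] it is the minimiser
    in [m] of the entropic cost minus [y * m]. *)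
Definition gibbs (R : realType) (eps : R) (C : \bar R) : R :=
  fine (expeR (- (C * (eps^-1)%:E))).

(** The value [+oo] at negative [m] turns the constraint [M >= 0] into part of the objective. *)
Definition entropic_cost (R : realType) (eps : R) (C : \bar R) (m : R) : \bar R :=
  if (0 <= m)%R then C * m%:E + (eps * (m * ln m - m + 1))%:E else +oo.

Section entropic_cost.
Variables (R : realType) (eps : R).
Hypothesis eps_gt0 : (0 < eps)%R.
Implicit Types (C : \bar R) (m y t : R).

(** For [m > 0] this is [1 + z <= expR z] at [z = ln t - ln m], multiplied by [m]. Strictness for
    nonzero [z] gives the equality case that follows. *)
Lemma relative_entropy_ge0 m t : (0 <= m)%R -> (0 < t)%R ->
  (m * ln t - t <= m * ln m - m)%R.
Proof.
rewrite le_eqVlt => /predU1P[<- t0|m0 t0]; first by rewrite !mul0r; lra.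
have := expR_ge1Dx (ln t - ln m); rewrite expRD expRN !lnK ?posrE//.
by rewrite ler_pdivlMr//; lra.
Qed.

Lemma relative_entropy_eq0 m t : (0 <= m)%R -> (0 < t)%R ->
  (m * ln m - m <= m * ln t - t)%R -> m = t.
Proof.
rewrite le_eqVlt => /predU1P[<- t0|m0 t0]; first by rewrite !mul0r; lra.
have [e _|e] := eqVneq (ln t - ln m)%R 0%R.
  by apply: ln_inj; rewrite ?posrE//; lra.
have := expR_gt1Dx e; rewrite expRD expRN !lnK ?posrE//.
by rewrite ltr_pdivlMr//; lra.
Qed.

Lemma gibbsy : gibbs eps +oo = 0%R.
Proof. by rewrite /gibbs gt0_mulye// lte_fin invr_gt0. Qed.

Lemma gibbs_fin (c : R) : gibbs eps c%:E = expR (- (c / eps)).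
Proof. by []. Qed.

Lemma gibbs_ge0 C : (0 <= gibbs eps C)%R.
Proof. by apply: fine_ge0; exact: expeR_ge0. Qed.

Let ln_gibbs (c y : R) :
  (eps * ln (gibbs eps c%:E * expR (y / eps)) = y - c)%R.
Proof. by rewrite gibbs_fin -expRD expRK; field; exact: lt0r_neq0. Qed.

Let gibbs_exp_gt0 (c y : R) : (0 < gibbs eps c%:E * expR (y / eps))%R.
Proof. by rewrite gibbs_fin mulr_gt0 ?expR_gt0. Qed.

Lemma entropic_cost_gtNy C m : -oo < C -> -oo < entropic_cost eps C m.
Proof.
rewrite /entropic_cost; case: ifPn => // m0; case: C => [c| |] // _.
  by rewrite -EFinM -EFinD ltNyr.
move: m0; rewrite le_eqVlt => /predU1P[<-|m0]; first by rewrite mule0 add0e ltNyr.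
by rewrite gt0_mulye ?lte_fin.
Qed.

(** Fenchel-Young inequality: for finite [C] it is the relative entropy bound at
    [t = gibbs eps C * expR (y / eps)], where [eps * ln t = y - C]. For [C = +oo] the kernel
    vanishes and only [m = 0] has finite cost. *)
Lemma entropic_cost_ge C m y : -oo < C ->
  (y * m + eps - eps * (gibbs eps C * expR (y / eps)))%:E
  <= entropic_cost eps C m.
Proof.
rewrite /entropic_cost; case: ifPn => [m0|_ _]; last exact: leey.
case: C => [c _| _|//].
  rewrite -EFinM -EFinD lee_fin.
  have := ler_wpM2l (ltW eps_gt0) (relative_entropy_ge0 m0 (gibbs_exp_gt0 c y)).
  have := congr1 ( *%R m) (ln_gibbs c y).
  set t := (gibbs eps c%:E * expR (y / eps))%R.
  move: t (ln t) => t L; lra.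
move: m0; rewrite le_eqVlt => /predU1P[<-|m0].
  by rewrite mule0 add0e lee_fin gibbsy !mul0r !mulr0; lra.
by rewrite gt0_mulye ?lte_fin// leey.
Qed.

Lemma entropic_cost_gibbs C y : -oo < C ->
  let t := (gibbs eps C * expR (y / eps))%R in
  entropic_cost eps C t = (y * t + eps - eps * t)%:E.
Proof.
move=> CN /=; rewrite /entropic_cost mulr_ge0 ?gibbs_ge0 ?expR_ge0//.
case: C CN => [c _| _|//].
  rewrite -EFinM -EFinD; congr EFin.
  have := ln_gibbs c y.
  set t := (gibbs eps c%:E * expR (y / eps))%R.
  move: t (ln t) => t L H.
  by rewrite (_ : y = eps * L + c)%R; [ring|lra].
by rewrite gibbsy !mul0r mule0 add0e; congr EFin; ring.
Qed.

Lemma entropic_cost_eq C m y : -oo < C ->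
  entropic_cost eps C m
  <= (y * m + eps - eps * (gibbs eps C * expR (y / eps)))%:E ->
  m = (gibbs eps C * expR (y / eps))%R.
Proof.
rewrite /entropic_cost; case: ifPn => [m0|_ _]; last by rewrite leNgt ltry.
case: C => [c _| _|//].
  rewrite -EFinM -EFinD lee_fin => H.
  apply: relative_entropy_eq0 => //.
  rewrite -(ler_pM2l eps_gt0); have := congr1 ( *%R m) (ln_gibbs c y); move: H.
  set t := (gibbs eps c%:E * expR (y / eps))%R.
  move: t (ln t) => t L; lra.
move: m0; rewrite le_eqVlt => /predU1P[<-|m0]; first by move=> _; rewrite gibbsy mul0r.
by rewrite gt0_mulye ?lte_fin// leNgt ltry.
Qed.

(** The minorants are those of [entropic_cost_ge]; what remains is to pick a slope [y] that beats a
    given level [a] at the given [m]. *)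
Lemma entropic_cost_sup_of_affine C : -oo < C ->
  sup_of_affine (entropic_cost eps C).
Proof.
move=> CN m a H.
suff [y hy] : exists y : R,
    (a < y * m + eps - eps * (gibbs eps C * expR (y / eps)))%R.
  exists y, (eps - eps * (gibbs eps C * expR (y / eps)))%R.
  split; first lra.
  by move=> x; rewrite addrA; exact: entropic_cost_ge.
have K0 := gibbs_ge0 C.
have [m0|m0|m0] := ltgtP m 0%R.
(* For [m < 0] this nonpositive slope makes [y * m] equal to [|a| + eps * gibbs eps C], while the
   exponential stays at most 1. *)
- exists (- (`|a| + eps * gibbs eps C) / - m)%R.
  set y := (_ / _)%R.
  have y0 : (y <= 0)%R.
    by rewrite pmulr_lle0 ?invr_gt0 ?oppr_gt0// oppr_le0 addr_ge0// mulr_ge0// ltW.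
  have -> : (y * m = `|a| + eps * gibbs eps C)%R.
    by rewrite /y; field; rewrite lt_eqF.
  have e1 : (expR (y / eps) <= 1)%R.
    by rewrite -expR0 ler_expR pmulr_lle0 ?invr_gt0.
  have : (eps * gibbs eps C * expR (y / eps) <= eps * gibbs eps C)%R.
    by rewrite ler_piMr// mulr_ge0// ltW.
  have := ler_norm a; move: eps_gt0 (expR _) => e0 e; lra.
- case: C CN H K0 => [c _| _|//].
    rewrite /entropic_cost (ltW m0) -EFinM -EFinD lte_fin => H K0.
    (* The derivative of the cost at [m]: the minorant is the tangent line and touches there. *)
    exists (c + eps * ln m)%R; rewrite gibbs_fin.
    rewrite (_ : (_ + _) / eps = c / eps + ln m)%R; last by field; exact: lt0r_neq0.
    rewrite expRD lnK ?posrE//.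
    rewrite (_ : expR (- (c / eps)) * _ = m)%R; first lra.
    by rewrite mulrA -expRD addNr expR0 mul1r.
  move=> _ _; exists ((a + 1) / m)%R; rewrite gibbsy mul0r mulr0 divfK ?lt0r_neq0//.
  move: eps_gt0; lra.
- move: H; rewrite m0 /entropic_cost lexx mule0 add0e lte_fin mul0r => H.
  (* At [m = 0] the cost is [eps], so [a < eps]. The denominator has [gibbs eps C + 1], which is
     positive even when the kernel vanishes. *)
  exists (eps * ln ((eps - a) / (eps * (gibbs eps C + 1))))%R.
  rewrite mulr0 add0r [(eps * ln _ / eps)%R]mulrAC divff ?lt0r_neq0// mul1r.
  rewrite lnK ?posrE; last first.
    by rewrite divr_gt0 ?mulr_gt0//; lra.
  set K := gibbs eps C in K0 *.
  have -> : (eps * (K * ((eps - a) / (eps * (K + 1)))) = (eps - a) * (K / (K + 1)))%R.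
    by field; rewrite !lt0r_neq0 ?ltr_wpDl.
  have : ((eps - a) * (K / (K + 1)) < (eps - a) * 1)%R.
    by rewrite ltr_pM2l ?ltr_pdivrMr; lra.
  lra.
Qed.

End entropic_cost.

(** * Linear lower bounds for convex functions *)

(** Lower semicontinuity bounds [h] below on the l1 unit ball around a point [x0] of finite value.
    For [x] outside, convexity along the segment from [x0] to [x] carries the bound at distance 1
    out to [x], at a cost linear in the distance. *)
Lemma convex_lsc_linear_growth (R : realType) (n : nat) (h : 'rV[R]_n -> \bar R) :
  (forall x, -oo < h x) -> (exists x, h x < +oo) ->
  convex_efun h -> lower_semicontinuous h ->
  exists A B : R, (0 <= B)%R /\ 
    forall x : 'rV[R]_n, (- A - B * \sum_i `|x 0 i|)%:E <= h x.
Proof.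
move=> hN [x0 hx0] cvh lh.
pose nrm (x : 'rV[R]_n) : R := (\sum_i `|x 0 i|)%R.
have nrm_cont : continuous (fun x : 'rV[R]_n => nrm (x - x0)%R).
  apply: (@continuous_big R _ +%R 0%R xpredT) => [|j _]; first exact: add_continuous.
  have -> : (fun y : 'rV[R]_n => `|(y - x0) 0 j|)%R = (fun y => `|y 0%R j - x0 0%R j|%R).
    by apply/funext => y; rewrite !mxE.
  have c : continuous (fun y : 'rV[R]_n => y 0%R j - x0 0%R j)%R.
    move=> x; exact: (cvgB (@coord_continuous _ _ _ 0%R j x) (cvg_cst _)).
  by move=> x; exact: (cvg_norm (c x)).
have [v hv] : exists v, h x0 = v%:E.
  by move: hx0 (hN x0); case: (h x0) => [v| |] //; exists v.
have [m0 hm0] : exists m : R, forall x, (nrm (x - x0)%R <= 1)%R -> (- m)%:E <= h x.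
  apply: contrapT => /forallNP nm.
  (* Were [h] unbounded below on the ball, its sublevel sets at [-k] there would share a point, at
     which [h] would be [-oo]. *)
  have [||||x hx] := @nested_closed_cap R n
      (fun k => [set x | (nrm (x - x0)%R)%:E <= 1%:E] `&` [set x | h x <= (- k%:R)%:E]) (1 + nrm x0)%R.
  - move=> k; apply: closedI; apply: lsc_closed_sublevel => //.
    exact: continuous_lsc.
  - by move=> k x [/= x1 /le_trans xk]; split => //; apply: xk; rewrite lee_fin lerN2 ler_nat.
  - move=> x [/= + _] i; rewrite lee_fin => x1.
    have le_nrm (z : 'rV[R]_n) : (`|z 0 i| <= nrm z)%R.
      by rewrite /nrm (bigD1 i)//= lerDl sumr_ge0.
    have := le_nrm x0; have := le_nrm (x - x0)%R; rewrite !mxE.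
    have := ler_normD (x 0 i - x0 0 i)%R (x0 0%R i); rewrite subrK; lra.
  - move=> k; apply: contrapT => e; apply: (nm k%:R) => x x1.
    by rewrite leNgt; apply/negP => /ltW xk; apply: e; exists x.
  have {}hx k : h x <= (- k%:R)%:E by case: (hx k).
  move: (hN x) hx; case: (h x) => [w| |] // _ hx; last by have := hx 0%N.
  have := hx (Num.truncn (- w)).+1; rewrite lee_fin => h1.
  have := truncnS_gt (- w)%R; lra.
pose m := (`|m0| + `|v|)%R.
have m_ge0 : (0 <= m)%R by rewrite addr_ge0.
have hm x : (nrm (x - x0)%R <= 1)%R -> (- m)%:E <= h x.
  move=> /hm0; apply: le_trans; rewrite lee_fin lerN2.
  by rewrite (le_trans (ler_norm _))// lerDl.
exists (2 * m * (1 + nrm x0))%R, (2 * m)%R; split; first by rewrite mulr_ge0.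
move=> x.
have nrm_ge0 z : (0 <= nrm z)%R by exact: sumr_ge0.
have nrmB : (nrm (x - x0)%R <= nrm x + nrm x0)%R.
  rewrite /nrm -big_split; apply: ler_sum => i _ /=; rewrite !mxE.
  exact: ler_normB.
have [x1|x1] := leP (nrm (x - x0)%R) 1%R.
  apply: le_trans (hm x x1); rewrite lee_fin.
  have := mulr_ge0 m_ge0 (nrm_ge0 x); have := mulr_ge0 m_ge0 (nrm_ge0 x0).
  by rewrite -/(nrm x); lra.
move: (hN x); case hx : (h x) => [w| |] // _; last by rewrite leey.
set rho := nrm (x - x0)%R in x1 nrmB.
have rho0 : (0 < rho)%R by lra.
have s01 : (0 <= rho^-1 <= 1)%R by rewrite invr_ge0 ltW//= invf_le1// ltW.
(* With weight [1/rho] on [x], the combination lies at distance exactly 1 from [x0]. *)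
have := cvh x x0 _ s01; rewrite hx hv -!EFinM -EFinD => /(le_trans (hm _ _)).
have -> : nrm (rho^-1 *: x + (1 - rho^-1) *: x0 - x0)%R = 1%R.
  rewrite /nrm (eq_bigr (fun i => rho^-1 * `|(x - x0) 0 i|)%R) => [|i _].
    by rewrite -mulr_sumr -/(nrm _) mulVf// lt0r_neq0.
  have /andP[s0 _] := s01.
  rewrite -[in RHS](ger0_norm s0) -normrM !mxE; congr (`| _ |)%R; ring.
rewrite lexx lee_fin => /(_ isT).
rewrite -(ler_pM2l rho0) => H.
have vm : (v <= m)%R by rewrite (le_trans (ler_norm _))// lerDr.
have E1 : (rho * (rho^-1 * w + (1 - rho^-1) * v) = w + (rho - 1) * v)%R.
  by field; exact: lt0r_neq0.
rewrite E1 in H; rewrite lee_fin -/(nrm x).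
have := mulr_ge0 m_ge0 (_ : 0 <= nrm x + nrm x0 - rho)%R; rewrite subr_ge0 => /(_ nrmB).
have : ((rho - 1) * v <= (rho - 1) * m)%R by rewrite ler_pM2l//; lra.
lra.
Qed.

(** * Composition, finite sums and the matrix pairing *)

Lemma lsc_comp (R : realType) (X Y : topologicalType) (f : Y -> \bar R)
    (u : X -> Y) :
  lower_semicontinuous f -> continuous u -> lower_semicontinuous (f \o u).
Proof.
move=> lf cu x a /lf[V Vx hV]; exists (u @^-1` V); first exact: cu.
by move=> y /hV.
Qed.

Lemma reindex_continuous (R : realType) (n p q : nat) (i : 'I_p -> 'I_q -> 'I_n) :
  continuous (fun x : 'rV[R]_n => (\matrix_(k, l) x 0 (i k l) : 'M[R]_(p, q)))%R.
Proof.
move=> x V /nbhs_ballP[e e0 eV]; apply/nbhs_ballP; exists e => // y xy.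
by apply: eV; split => // k l; rewrite !mxE; exact: xy.2.
Qed.

Lemma esum_lty_term (R : realType) (I : finType) (f : I -> \bar R) (i : I) :
  (forall j, -oo < f j) -> \sum_j f j < +oo -> f i < +oo.
Proof.
move=> fN; rewrite (bigD1 i)//=.
have : -oo < \sum_(j | j != i) f j.
  by rewrite big_mkcond; apply: esum_gtNy => j; case: ifP => // _; exact: ltNyr.
case: (f i) => [r| |] //; first by rewrite ltry.
by case: (\sum_(_ | _) _).
Qed.

Lemma mxdotE (R : realType) (m n : nat) (x y : 'M[R]_(m, n)) :
  mxdot x y = (\sum_i \sum_j x i j * y i j)%R.
Proof.
rewrite /mxdot /mxtrace exchange_big; apply: eq_bigr => j _.
by rewrite !mxE; apply: eq_bigr => i _; rewrite mxE.
Qed.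

Lemma mxdotBr (R : realType) (m n : nat) (x y z : 'M[R]_(m, n)) :
  mxdot x (y - z)%R = (mxdot x y - mxdot x z)%R.
Proof. by rewrite /mxdot mulmxBr raddfB. Qed.

Lemma mxdotNl (R : realType) (m n : nat) (x y : 'M[R]_(m, n)) :
  mxdot (- x)%R y = (- mxdot x y)%R.
Proof. by rewrite /mxdot raddfN mulNmx raddfN. Qed.

(** * The primal problem in a single vector variable *)

Section problem.
Variables (R : realType) (T N : nat) (E : {set 'I_T * 'I_T}).
Variables (eps : R) (C : tensor T N (\bar R)).
Variables (g : 'I_T -> 'cV[R]_N -> \bar R) (f : edge E -> 'M[R]_N -> \bar R).
Hypothesis eps_gt0 : (0 < eps)%R.
Hypothesis C_gtNy : forall i, -oo < C i.
Hypothesis g_pcl : forall t, proper_convex_lsc (g t).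
Hypothesis f_pcl : forall e, proper_convex_lsc (f e).

Let g_gtNy t x : -oo < g t x. Proof. by have [[h _] _ _] := g_pcl t. Qed.
Let f_gtNy e x : -oo < f e x. Proof. by have [[h _] _ _] := f_pcl e. Qed.

Lemma primal_objectiveE (M : tensor T N R) mu Rm : nonneg_tensor M ->
  primal_objective eps C g f M mu Rm =
  \sum_i entropic_cost eps (C i) (M i)
  + (\sum_t g t (mu t) + \sum_e f e (Rm e)).
Proof.
move=> M0; rewrite /primal_objective -addeA; congr (_ + _).
rewrite /cost /entropy mulr_sumr -sumEFin -big_split /=.
by apply: eq_bigr => i _; rewrite /entropic_cost M0.
Qed.

(** Indexes the scalar constraints and equally the entries of mu and R, since each constraint
    prescribes one such entry. [Var] adds the entries of M. *)
Let Con : finType := (('I_T * 'I_N) + (edge E * ('I_N * 'I_N)))%type.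
Let Var : finType := (multi_index T N + Con)%type.
Let n := #|{: Var}|.

Let co (x : 'rV[R]_n) (j : Var) : R := x 0%R (enum_rank j).
Let xM x : tensor T N R := fun i => co x (inl i).
Let xmu x : 'I_T -> 'cV[R]_N := fun t => (\matrix_(k, l) co x (inr (inl (t, k))))%R.
Let xR x : edge E -> 'M[R]_N := fun e => (\matrix_(k, l) co x (inr (inr (e, (k, l)))))%R.

Let pack (M : tensor T N R) (mu : 'I_T -> 'cV[R]_N) (Rm : edge E -> 'M[R]_N) : 'rV[R]_n :=
  (\row_j match enum_val j with
   | inl i => M i
   | inr (inl (t, k)) => mu t k 0
   | inr (inr (e, (k, l))) => Rm e k l
   end)%R.

Let xM_pack M mu Rm : xM (pack M mu Rm) = M.
Proof. by apply/funext => i; rewrite /xM /co mxE enum_rankK. Qed.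

Let xmu_pack M mu Rm : xmu (pack M mu Rm) = mu.
Proof.
by apply/funext => t; apply/matrixP => k l; rewrite /xmu /co !mxE enum_rankK ord1.
Qed.

Let xR_pack M mu Rm : xR (pack M mu Rm) = Rm.
Proof.
by apply/funext => t; apply/matrixP => k l; rewrite /xR /co !mxE enum_rankK.
Qed.

Let sel (j : Con) (i : multi_index T N) : bool :=
  match j with
  | inl (t, k) => i t == k
  | inr (e, (k, l)) => (i (val e).1 == k) && (i (val e).2 == l)
  end.

Let res (j : Con) (x : 'rV[R]_n) : R :=
  (co x (inr j) - \sum_(i | sel j i) co x (inl i))%R.

Let resT x t k : res (inl (t, k)) x = ((xmu x t - marginal t (xM x)) k 0)%R.
Proof. by rewrite /res !mxE. Qed.

Let resE x e k l : res (inr (e, (k, l))) x = ((xR x e - bimarginal e (xM x)) k l)%R.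
Proof. by rewrite /res !mxE. Qed.

Let res_cont j : continuous (res j).
Proof.
have c v : continuous (fun x : 'rV[R]_n => co x v) by exact: coord_continuous.
have cs : continuous (fun x : 'rV[R]_n => \sum_(i | sel j i) co x (inl i))%R.
  apply: (@continuous_big R _ +%R 0%R) => [|i _]; first exact: add_continuous.
  exact: c.
by move=> x; exact: (cvgB (@c (inr j) x) (@cs x)).
Qed.

Let res_affine j x y s :
  res j (s *: x + (1 - s) *: y)%R = (s * res j x + (1 - s) * res j y)%R.
Proof.
rewrite /res /co; under eq_bigr do rewrite !mxE.
by rewrite big_split /= -!mulr_sumr !mxE; ring.
Qed.

Let G x := \sum_t g t (xmu x t) + \sum_e f e (xR x e).
Let h x := \sum_i entropic_cost eps (C i) (xM x i) + G x.

Let G_gtNy x : -oo < G x.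
Proof.
have := esum_gtNy (index_enum _) (fun t => g_gtNy t (xmu x t)).
have := esum_gtNy (index_enum _) (fun e => f_gtNy e (xR x e)).
rewrite /G; case: (\sum_t _) => [r| |] //; case: (\sum_e _) => [s| |] // _ _.
exact: ltNyr.
Qed.

Let ent_gtNy x : -oo < \sum_i entropic_cost eps (C i) (xM x i).
Proof. by apply: esum_gtNy => i; exact: entropic_cost_gtNy. Qed.

Let h_gtNy x : -oo < h x.
Proof.
have := G_gtNy x; have := ent_gtNy x.
rewrite /h; case: (\sum_i _) => [r| |] //; case: (G x) => [s| |] // _ _.
exact: ltNyr.
Qed.

Let G_convex : convex_efun G.
Proof.
apply: convex_efunD => [x|x||]; try by apply: esum_gtNy.
  apply: convex_efun_sum => // t x y s s01; have [_ cg _] := g_pcl t.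
  have -> : xmu (s *: x + (1 - s) *: y)%R t = (s *: xmu x t + (1 - s) *: xmu y t)%R.
    by apply/matrixP => k l; rewrite /xmu /co !mxE.
  exact: cg.
apply: convex_efun_sum => // e x y s s01; have [_ cf _] := f_pcl e.
have -> : xR (s *: x + (1 - s) *: y)%R e = (s *: xR x e + (1 - s) *: xR y e)%R.
  by apply/matrixP => k l; rewrite /xR /co !mxE.
exact: cf.
Qed.

Let G_lsc : lower_semicontinuous G.
Proof.
apply: lscD => [x|x||]; try by apply: esum_gtNy.
  apply: lsc_sum => // t; have [_ _ lg] := g_pcl t.
  by apply: (lsc_comp lg); exact: reindex_continuous.
apply: lsc_sum => // e; have [_ _ lf] := f_pcl e.
by apply: (lsc_comp lf); exact: reindex_continuous.
Qed.

Let h_convex : convex_efun h.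
Proof.
apply: convex_efunD => //; apply: convex_efun_sum => [i x|i]; first exact: entropic_cost_gtNy.
apply: (@sup_of_affine_convex _ _ _ (entropic_cost eps (C i))).
- by move=> z; exact: entropic_cost_gtNy.
- exact: entropic_cost_sup_of_affine.
- by move=> x y s; rewrite /xM /co !mxE.
Qed.

Let h_lsc : lower_semicontinuous h.
Proof.
apply: lscD => //; apply: lsc_sum => [i x|i]; first exact: entropic_cost_gtNy.
apply: (@sup_of_affine_lsc _ _ (entropic_cost eps (C i))).
  exact: entropic_cost_sup_of_affine.
exact: coord_continuous.
Qed.

Let G_lty : exists x, G x < +oo /\ xM x = (fun=> 0%R).
Proof.
have /choice[mu hmu] : forall t, exists x, g t x < +oo by move=> t; have [[]] := g_pcl t.
have /choice[Rm hRm] : forall e, exists x, f e x < +oo by move=> e; have [[]] := f_pcl e.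
exists (pack (fun=> 0%R) mu Rm); rewrite /G xM_pack xmu_pack xR_pack; split => //.
by apply: lte_add_pinfty; apply: lte_sum_pinfty.
Qed.

Let h_lty : exists x, h x < +oo.
Proof.
have [x [Gx Mx]] := G_lty; exists x; apply: lte_add_pinfty => //.
apply: lte_sum_pinfty => i _; rewrite Mx /entropic_cost lexx mule0 add0e.
exact: ltry.
Qed.

Let h_nonneg x : h x < +oo -> nonneg_tensor (xM x).
Proof.
move=> hx i; rewrite leNgt; apply/negP => M0.
have : \sum_i entropic_cost eps (C i) (xM x i) < +oo.
  by move: hx (G_gtNy x); rewrite /h; case: (\sum_i _) => [r _ _| |] //;
    rewrite ?ltry//; case: (G x).
move=> /(esum_lty_term i) => /(_ (fun j => entropic_cost_gtNy _ _ (C_gtNy j))).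
by rewrite /entropic_cost leNgt M0.
Qed.

(** Let [S] be the mass of M and [rho] the l1 norm of the residuals. All coordinates are controlled
    by [S] and [rho]; [G] falls at most linearly in them, whereas the entropy grows faster than any
    multiple of [S] and the squared residuals faster than any multiple of [rho]. *)
Let coercive (a : R) : exists b : R, forall x,
  h x + (\sum_j res j x ^+ 2)%:E <= a%:E -> forall i, (`|x 0 i| <= b)%R.
Proof.
have [|A [B [B0 GAB]]] := convex_lsc_linear_growth G_gtNy _ G_convex G_lsc.
  by have [x [Gx _]] := G_lty; exists x.
pose q : R := #|{: Con}|%:R.
(* The slope for the entropy: after the loss [B * (1 + q) * S] allowed by [G], one copy of [S] is
   left. The slope [B + 1] for the residuals leaves one copy of [rho] in the same way. *)
pose y := (B * (1 + q) + 1)%R.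
pose K := (\sum_(i : multi_index T N) (eps - eps * (gibbs eps (C i) * expR (y / eps))))%R.
exists ((1 + q) * (a - K + A + q * (B + 1) ^+ 2))%R => x xa i.
have q0 : (0 <= q)%R by exact: ler0n.
have M0 : nonneg_tensor (xM x).
  apply: h_nonneg; move: xa; case: (h x) => [r| |] //; first by rewrite ltry.
pose S := (\sum_i xM x i)%R; pose rho := (\sum_j `|res j x|)%R.
pose l1 := (\sum_i `|x 0 i|)%R.
have S0 : (0 <= S)%R by exact: sumr_ge0.
have rho0 : (0 <= rho)%R by exact: sumr_ge0.
(* Each of the [q] entries of mu and R is a partial sum of M, at most [S], plus a residual. *)
have l1E : (l1 <= (1 + q) * S + rho)%R.
  have -> : l1 = (\sum_(j : Var) `|co x j|)%R.
    rewrite /l1 (reindex (@enum_rank Var)) //=; exact: onW_bij (@enum_rank_bij Var).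
  rewrite big_sumType /= mulrDl mul1r -addrA; apply: lerD.
    by apply: ler_sum => k _; rewrite ger0_norm// M0.
  rewrite /q -sumr_const mulr_suml /rho -big_split /=.
  apply: ler_sum => j _.
  have -> : co x (inr j) = (\sum_(i | sel j i) co x (inl i) + res j x)%R.
    by rewrite /res addrC subrK.
  rewrite mul1r (le_trans (ler_normD _ _))// lerD2r ger0_norm; last first.
    by apply: sumr_ge0 => k _; exact: M0.
  by rewrite /S [leRHS](bigID (sel j))/= lerDl sumr_ge0.
have sq : ((B + 1) * rho - q * (B + 1) ^+ 2 <= \sum_j res j x ^+ 2)%R.
  rewrite /rho /q -sumr_const mulr_sumr mulr_suml -sumrB; apply: ler_sum => j _.
  rewrite -(real_normK (num_real (res j x))) mul1r.
  move: (B + 1)%R (`|res j x|%R : R) => b t.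
  have := sqr_ge0 (t - b / 2)%R; have := sqr_ge0 b; lra.
have xle : (`|x 0 i| <= l1)%R by rewrite /l1 (bigD1 i)//= lerDl sumr_ge0.
have ent : (y * S + K)%:E <= \sum_i entropic_cost eps (C i) (xM x i).
  rewrite /S /K mulr_sumr -big_split /= -sumEFin; apply: lee_sum => k _.
  by rewrite addrA; exact: entropic_cost_ge.
have : (y * S + K + (- A - B * l1) + ((B + 1) * rho - q * (B + 1) ^+ 2))%:E <= a%:E.
  apply: le_trans xa; rewrite 2!EFinD; apply: leeD; last by rewrite lee_fin.
  by apply: leeD => //; exact: GAB.
rewrite lee_fin /y => H.
have : (S + rho <= a - K + A + q * (B + 1) ^+ 2)%R.
  have := ler_wpM2l B0 l1E; lra.
move: (a - K + A + _)%R => Z SZ.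
have := ler_wpM2l (addr_ge0 ler01 q0) SZ; have := mulr_ge0 q0 rho0; lra.
Qed.

Let lamOf (l : Con -> R) : 'I_T -> 'cV[R]_N := fun t => (\col_k l (inl (t, k)))%R.
Let LamOf (l : Con -> R) : edge E -> 'M[R]_N :=
  fun e => (\matrix_(k, k') l (inr (e, (k, k'))))%R.

Let pairing_res l x :
  (\sum_j l j * res j x =
   \sum_t mxdot (lamOf l t) (xmu x t - marginal t (xM x))
   + \sum_e mxdot (LamOf l e) (xR x e - bimarginal e (xM x)))%R.
Proof.
rewrite big_sumType /=; congr (_ + _)%R.
  rewrite (eq_bigr (fun p => l (inl (p.1, p.2)) * res (inl (p.1, p.2)) x)%R); last by case.
  rewrite -(pair_bigA _ (fun t k => l (inl (t, k)) * res (inl (t, k)) x)%R) /=.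
  apply: eq_bigr => t _; rewrite mxdotE; apply: eq_bigr => k _.
  by rewrite big_ord1 resT [in RHS]mxE.
rewrite (eq_bigr (fun p => l (inr (p.1, p.2)) * res (inr (p.1, p.2)) x)%R); last by case.
rewrite -(pair_bigA _ (fun e k => l (inr (e, k)) * res (inr (e, k)) x)%R) /=.
apply: eq_bigr => e _; rewrite mxdotE pair_bigA; apply: eq_bigr => -[k k'] _.
by rewrite resE [in RHS]mxE.
Qed.

Let lagrangianE l M mu Rm : nonneg_tensor M ->
  lagrangian eps C g f M mu Rm (lamOf l) (LamOf l)
  = h (pack M mu Rm) + (\sum_j l j * res j (pack M mu Rm))%:E.
Proof.
move=> M0; rewrite pairing_res /lagrangian EFinD addeA primal_objectiveE//.
by rewrite /h /G xM_pack xmu_pack xR_pack.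
Qed.

Let dual_function_ge l (c : R) :
  (forall x, c%:E <= h x + (\sum_j l j * res j x)%:E) ->
  c%:E <= dual_function eps C g f (lamOf l) (LamOf l).
Proof.
move=> hc; apply/ereal_infP => _ [M [mu [Rm [M0 ->]]]].
by rewrite lagrangianE.
Qed.

Lemma dual_function_proper : exists lam Lam,
  -oo < dual_function eps C g f lam Lam.
Proof.
have [l [c hc]] := dual_proper h_gtNy h_lty h_convex h_lsc res_cont res_affine coercive.
exists (lamOf l), (LamOf l).
exact: lt_le_trans (ltNyr c) (dual_function_ge hc).
Qed.

(** [penalty_duality] read back in tensors: vanishing residuals are the marginal constraints, and a
    finite objective forces M to be nonnegative. *)
Lemma primal_point_of_dual_bound (d : R) :
  (forall lam Lam, dual_function eps C g f lam Lam <= d%:E) ->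
  exists M mu Rm, primal_feasible M mu Rm /\
    primal_objective eps C g f M mu Rm <= d%:E.
Proof.
move=> hd.
have [|x [rx hx]] :=
    penalty_duality (d := d) h_gtNy h_lty h_convex h_lsc res_cont res_affine coercive.
  move=> l c hc; rewrite -lee_fin.
  exact: le_trans (dual_function_ge hc) (hd _ _).
have M0 : nonneg_tensor (xM x) by apply: h_nonneg; exact: le_lt_trans hx (ltry _).
exists (xM x), (xmu x), (xR x); split; last by rewrite primal_objectiveE.
split => // [t|e]; apply/esym/eqP; rewrite -subr_eq0; apply/eqP/matrixP => k l.
  by rewrite ord1 -resT rx mxE.
by rewrite -resE rx mxE.
Qed.

End problem.

(** * Infima of separable sums and Fenchel conjugates *)

Lemma ereal_inf_lty (R : realType) (X : Type) (u : X -> \bar R) :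
  (exists x, u x < +oo) -> ereal_inf (range u) < +oo.
Proof.
by move=> [x ux]; apply: le_lt_trans ux; apply: ereal_inf_lbound; exists x.
Qed.

(** For real [v], subtract it and bound pointwise. For [v = -oo], the point where [u] is below [+oo]
    forces [c = -oo]. *)
Lemma le_add_ereal_inf (R : realType) (X : Type) (u : X -> \bar R) (c v : \bar R) :
  (exists x, u x < +oo) -> v < +oo ->
  (forall x, u x < +oo -> c <= v + u x) -> c <= v + ereal_inf (range u).
Proof.
move=> ufin; case: v => [v| |] // _ H; last first.
  by have [x ux] := ufin; have := H x ux; rewrite !addNye.
rewrite -leeBlDl//; apply/ereal_infP => _ [x _ <-]; rewrite leeBlDl//.
by have [ux|] := ltP (u x) +oo; [exact: H|rewrite leye_eq => /eqP ->; rewrite addey// leey].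
Qed.

(* The coordinates of mu are optimised one at a time. *)
Lemma le_sum_ereal_inf (R : realType) (I : finType) (X : Type)
    (u : I -> X -> \bar R) (c : \bar R) (w : R) :
  (forall i x, -oo < u i x) -> (forall i, exists x, u i x < +oo) ->
  (forall mu : I -> X, (forall i, u i (mu i) < +oo) ->
     c <= w%:E + \sum_i u i (mu i)) ->
  c <= w%:E + \sum_i ereal_inf (range (u i)).
Proof.
move=> uN ufin; have := index_enum_uniq I.
elim: (index_enum I) w => [w _ H|i s IH w].
  have [mu hmu] := choice ufin.
  by have := H mu hmu; rewrite !big_nil.
rewrite cons_uniq => /andP[is_ us] H; rewrite big_cons addeCA addeC.
apply: le_add_ereal_inf => // [|x ux].
  apply: lte_add_pinfty; rewrite ?ltry//.
  by apply: lte_sum_pinfty => j _; exact: ereal_inf_lty.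
have [r ur] : exists r, u i x = r%:E.
  by move: ux (uN i x); case: (u i x) => [r| |] //; exists r.
(* The real value at coordinate [i] is absorbed into [w], over which the induction is general. *)
rewrite ur addeAC -EFinD; apply: IH => // mu hmu.
have := H (fun j => if j == i then x else mu j).
rewrite big_cons eqxx ur addeA -EFinD.
rewrite (eq_big_seq (fun j => u j (mu j))) => [|j js].
  by apply => j; case: eqVneq => [->|_].
by case: eqVneq => // ji; rewrite -ji js in is_.
Qed.

Lemma oppe_fenchel_conjugate (R : realType) (m n : nat)
    (h : 'M[R]_(m, n) -> \bar R) (y : 'M[R]_(m, n)) :
  - fenchel_conjugate h (- y)%R
  = ereal_inf (range (fun x => h x + (mxdot y x)%:E)).
Proof.
rewrite /fenchel_conjugate ereal_infEN; congr (- ereal_sup _).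
apply/seteqP; split => [_ [x _ <-]|_ [_ [x _ <-] <-]].
  exists (h x + (mxdot y x)%:E); first by exists x.
  by rewrite /= mxdotNl; case: (h x) => //= r; congr EFin; ring.
by exists x => //; rewrite /= mxdotNl; case: (h x) => //= r; congr EFin; ring.
Qed.

Lemma fenchel_conjugate_gtNy (R : realType) (m n : nat)
    (h : 'M[R]_(m, n) -> \bar R) (y : 'M[R]_(m, n)) :
  proper_fun h -> -oo < fenchel_conjugate h y.
Proof.
move=> [hN [x hx]]; apply: (@lt_le_trans _ _ ((mxdot y x)%:E - h x)).
  by move: hx; case: (h x) => [r| |] // _; rewrite ltNyr.
by apply: ereal_sup_ubound; exists x.
Qed.

(** * The dual function, strong duality and the form of the optimum *)

Section dual.
Variables (R : realType) (T N : nat) (E : {set 'I_T * 'I_T}).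
Variables (eps : R) (C : tensor T N (\bar R)).
Variables (g : 'I_T -> 'cV[R]_N -> \bar R) (f : edge E -> 'M[R]_N -> \bar R).
Hypothesis eps_gt0 : (0 < eps)%R.
Hypothesis C_gtNy : forall i, -oo < C i.
Hypothesis g_pcl : forall t, proper_convex_lsc (g t).
Hypothesis f_pcl : forall e, proper_convex_lsc (f e).
Implicit Types (M : tensor T N R) (i : multi_index T N) (e : edge E).
Implicit Types (mu lam : 'I_T -> 'cV[R]_N) (Rm Lam : edge E -> 'M[R]_N).

Let g_gtNy t x : -oo < g t x. Proof. by have [[h _] _ _] := g_pcl t. Qed.
Let f_gtNy e x : -oo < f e x. Proof. by have [[h _] _ _] := f_pcl e. Qed.

(** The total multiplier acting on the entry [i] of M, which is [eps] times the logarithm of that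
    entry of U. *)
Definition potential lam Lam i : R :=
  (\sum_t lam t (i t) 0 + \sum_e Lam e (i (val e).1) (i (val e).2))%R.

Lemma scaling_tensorE lam Lam i :
  scaling_tensor eps lam Lam i = expR (potential lam Lam i / eps).
Proof. by rewrite /scaling_tensor -!expR_sum -expRD mulrDl !mulr_suml. Qed.

Lemma mxdot_marginal (l : 'cV[R]_N) t M :
  mxdot l (marginal t M) = (\sum_(i : multi_index T N) l (i t) 0 * M i)%R.
Proof.
rewrite mxdotE (partition_big (fun i : multi_index T N => i t) xpredT)//=.
apply: eq_bigr => k _; rewrite big_ord1 mxE mulr_sumr.
by apply: eq_bigr => i /eqP ->.
Qed.

Lemma mxdot_bimarginal (L : 'M[R]_N) e M :
  mxdot L (bimarginal e M)
  = (\sum_(i : multi_index T N) L (i (val e).1) (i (val e).2) * M i)%R.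
Proof.
rewrite mxdotE pair_bigA.
rewrite (partition_big (fun i : multi_index T N => (i (val e).1, i (val e).2)) xpredT)//=.
apply: eq_bigr => -[k l] _; rewrite mxE mulr_sumr.
by apply: eq_big => [i|i /andP[/eqP -> /eqP ->]//]; rewrite xpair_eqE.
Qed.

Lemma marginal_pairing lam Lam M :
  (\sum_t mxdot (lam t) (marginal t M) + \sum_e mxdot (Lam e) (bimarginal e M)
   = \sum_i potential lam Lam i * M i)%R.
Proof.
under eq_bigr do rewrite mxdot_marginal.
under [X in (_ + X)%R]eq_bigr do rewrite mxdot_bimarginal.
rewrite exchange_big [X in (_ + X)%R]exchange_big -big_split /=.
by apply: eq_bigr => i _; rewrite -!mulr_suml mulrDl.
Qed.

Let ent y M := \sum_i (entropic_cost eps (C i) (M i) - (y i * M i)%:E).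
Let gt lam t x := g t x + (mxdot (lam t) x)%:E.
Let fe Lam e x := f e x + (mxdot (Lam e) x)%:E.

(** By adjointness of the marginal maps, the multipliers act on M through the potential, so M, mu
    and R no longer interact. *)
Lemma lagrangian_separable M mu Rm lam Lam : nonneg_tensor M ->
  lagrangian eps C g f M mu Rm lam Lam
  = ent (potential lam Lam) M + \sum_t gt lam t (mu t)
    + \sum_e fe Lam e (Rm e).
Proof.
move=> M0; rewrite /lagrangian primal_objectiveE// /ent /gt /fe !big_split /=.
rewrite !sumEFin.
rewrite (eq_bigr _ (fun t _ => mxdotBr (lam t) (mu t) (marginal t M))).
rewrite (eq_bigr _ (fun e _ => mxdotBr (Lam e) (Rm e) (bimarginal e M))).
rewrite !sumrB -!addeA; congr (_ + _).
rewrite sumrN -marginal_pairing.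
have regroup (u v : \bar R) (p q r s : R) : u + (v + ((p - q)%:E + (r - s)%:E))
    = (- (q + s))%:E + (u + (p%:E + (v + r%:E))).
  by case: u => [u| |] //; case: v => [v| |] //; congr EFin; ring.
exact: regroup.
Qed.

(** The discarded constant: it comes from the [+ 1] in each entropy term. Next, [w] is the minimum
    of the block [ent], attained at [Ms]. *)
Let c := (\sum_(i : multi_index T N) eps)%R.
Let w lam Lam : R :=
  (c - eps * tensor_dot (kernel_tensor eps C) (scaling_tensor eps lam Lam))%R.
Let Ms lam Lam : tensor T N R :=
  tensor_mul (kernel_tensor eps C) (scaling_tensor eps lam Lam).

Let MsE lam Lam i : Ms lam Lam i
  = (gibbs eps (C i) * expR (potential lam Lam i / eps))%R.
Proof. by rewrite /Ms /tensor_mul scaling_tensorE. Qed.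

Let Ms_ge0 lam Lam : nonneg_tensor (Ms lam Lam).
Proof. by move=> i; rewrite MsE mulr_ge0 ?gibbs_ge0 ?expR_ge0. Qed.

Let wE lam Lam : w lam Lam = (\sum_i (eps - eps * Ms lam Lam i))%R.
Proof. by rewrite sumrB -mulr_sumr. Qed.

Let ent_term_ge lam Lam M i : (eps - eps * Ms lam Lam i)%:E
  <= entropic_cost eps (C i) (M i) - (potential lam Lam i * M i)%:E.
Proof.
rewrite leeBrDr// -EFinD addrC addrA MsE; exact: entropic_cost_ge.
Qed.

Let ent_ge lam Lam M : (w lam Lam)%:E <= ent (potential lam Lam) M.
Proof. by rewrite wE -sumEFin; apply: lee_sum => i _; exact: ent_term_ge. Qed.

Let ent_Ms lam Lam : ent (potential lam Lam) (Ms lam Lam) = (w lam Lam)%:E.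
Proof.
rewrite wE -sumEFin; apply: eq_bigr => i _.
rewrite MsE entropic_cost_gibbs// -EFinB; congr EFin; ring.
Qed.

(** Every term is at least its minimum, so a total no larger than the sum of the minima leaves no
    excess in any term; the scalar minimisers are unique. *)
Let ent_eq lam Lam M : ent (potential lam Lam) M <= (w lam Lam)%:E ->
  M = Ms lam Lam.
Proof.
move=> H; apply/funext => i.
pose u j := entropic_cost eps (C j) (M j) - (potential lam Lam j * M j)%:E.
have ui : u i <= (eps - eps * Ms lam Lam i)%:E.
  rewrite leNgt; apply/negP => lt.
  move: H; apply/negP; rewrite -ltNge wE -sumEFin /ent (bigD1 i)//= [ltRHS](bigD1 i)//=.
  apply: lte_leD => //; first by rewrite sumEFin.
  by apply: lee_sum => j _; exact: ent_term_ge.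
move: ui; rewrite /u leeBlDr// -EFinD MsE => ui; apply: entropic_cost_eq => //.
by apply: le_trans ui _; rewrite lee_fin; lra.
Qed.

Let gt_gtNy lam t x : -oo < gt lam t x.
Proof. by rewrite /gt; move: (g_gtNy t x); case: (g t x) => [r| |] // _; rewrite ltNyr. Qed.

Let fe_gtNy Lam e x : -oo < fe Lam e x.
Proof. by rewrite /fe; move: (f_gtNy e x); case: (f e x) => [r| |] // _; rewrite ltNyr. Qed.

Let gt_lty lam t : exists x, gt lam t x < +oo.
Proof.
have [[_ [x gx]] _ _] := g_pcl t; exists x; rewrite /gt.
by move: gx; case: (g t x) => [r| |] // _; rewrite -EFinD ltry.
Qed.

Let fe_lty Lam e : exists x, fe Lam e x < +oo.
Proof.
have [[_ [x fx]] _ _] := f_pcl e; exists x; rewrite /fe.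
by move: fx; case: (f e x) => [r| |] // _; rewrite -EFinD ltry.
Qed.

Let dual_objectiveE lam Lam : dual_objective eps C g f lam Lam + c%:E
  = (w lam Lam)%:E + \sum_t ereal_inf (range (gt lam t))
    + \sum_e ereal_inf (range (fe Lam e)).
Proof.
(* Negation passes through the sums because no conjugate of a proper function is [-oo]. *)
rewrite /dual_objective -!sumeN; first last.
- move=> t t' _ _.
  have := fenchel_conjugate_gtNy (- lam t)%R (let: And3 p _ _ := g_pcl t in p).
  have := fenchel_conjugate_gtNy (- lam t')%R (let: And3 p _ _ := g_pcl t' in p).
  by case: fenchel_conjugate => [?| |] //; case: fenchel_conjugate.
- move=> t t' _ _.
  have := fenchel_conjugate_gtNy (- Lam t)%R (let: And3 p _ _ := f_pcl t in p).
  have := fenchel_conjugate_gtNy (- Lam t')%R (let: And3 p _ _ := f_pcl t' in p).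
  by case: fenchel_conjugate => [?| |] //; case: fenchel_conjugate.
rewrite (eq_bigr _ (fun t _ => oppe_fenchel_conjugate (g t) (lam t))).
rewrite (eq_bigr _ (fun e _ => oppe_fenchel_conjugate (f e) (Lam e))).
by rewrite [LHS]addeAC [X in X + _ = _]addeAC /w EFinD (addeC c%:E).
Qed.

(** The lower bound holds block by block. For the upper bound, M is set to its minimiser [Ms], then
    the infimum is taken over R for fixed mu, and finally over mu; this order keeps all but one
    block real. *)
Lemma dual_functionE lam Lam :
  dual_function eps C g f lam Lam = dual_objective eps C g f lam Lam + c%:E.
Proof.
rewrite dual_objectiveE; apply/eqP; rewrite eq_le; apply/andP; split; last first.
  apply/ereal_infP => _ [M [mu [Rm [M0 ->]]]].
  rewrite lagrangian_separable//; apply: leeD; first apply: leeD => //.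
    by apply: lee_sum => t _; apply: ereal_inf_lbound; exists (mu t).
  by apply: lee_sum => e _; apply: ereal_inf_lbound; exists (Rm e).
have step mu : (forall t, gt lam t (mu t) < +oo) ->
  dual_function eps C g f lam Lam <=
  (w lam Lam)%:E + \sum_t gt lam t (mu t) + \sum_e ereal_inf (range (fe Lam e)).
  move=> hmu; have [r hr] : exists r, \sum_t gt lam t (mu t) = r%:E.
    have : \sum_t gt lam t (mu t) < +oo by exact: lte_sum_pinfty.
    have := esum_gtNy (index_enum _) (fun t => gt_gtNy lam t (mu t)).
    by case: (\sum_t _) => [r| |] //; exists r.
  rewrite hr -EFinD; apply: le_sum_ereal_inf => // Rm hRm.
  rewrite EFinD -hr -ent_Ms -lagrangian_separable//.
  by apply: ereal_inf_lbound; exists (Ms lam Lam), mu, Rm.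
have vy : \sum_e ereal_inf (range (fe Lam e)) < +oo.
  by apply: lte_sum_pinfty => e _; exact: ereal_inf_lty.
case: (\sum_e _) vy step => [v| |] // _ step.
  rewrite addeAC -EFinD; apply: le_sum_ereal_inf => // mu hmu.
  by rewrite EFinD addeAC; exact: step.
(* Here the R block has infimum [-oo], and a single admissible mu suffices. *)
have [mu hmu] := choice (gt_lty lam).
by have := step mu hmu; rewrite !addeNy.
Qed.

Lemma lagrangian_feasible lam Lam M mu Rm : primal_feasible M mu Rm ->
  lagrangian eps C g f M mu Rm lam Lam = primal_objective eps C g f M mu Rm.
Proof.
move=> [M0 Mmu MR]; rewrite /lagrangian.
rewrite big1 => [|t _]; last by rewrite Mmu subrr /mxdot mulmx0 raddf0.
by rewrite big1 => [|e _]; [rewrite !adde0|rewrite MR subrr /mxdot mulmx0 raddf0].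
Qed.

Lemma dual_le_primal lam Lam M mu Rm : primal_feasible M mu Rm ->
  dual_function eps C g f lam Lam <= primal_objective eps C g f M mu Rm.
Proof.
move=> feas; rewrite -(lagrangian_feasible lam Lam feas); apply: ereal_inf_lbound.
by exists M, mu, Rm; split => //; case: feas.
Qed.

Lemma dual_function_lty lam Lam : dual_function eps C g f lam Lam < +oo.
Proof.
rewrite dual_functionE dual_objectiveE.
apply: lte_add_pinfty; first apply: lte_add_pinfty; rewrite ?ltry//.
  by apply: lte_sum_pinfty => t _; exact: ereal_inf_lty.
by apply: lte_sum_pinfty => e _; exact: ereal_inf_lty.
Qed.

(** The bound [d] and a proper dual make the dual value real. Taking that value itself as the bound
    yields a feasible point of no larger objective, and weak duality makes it optimal. *)
Lemma primal_optimal_of_dual_bound (d : R) :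
  (forall lam Lam, dual_function eps C g f lam Lam <= d%:E) ->
  exists M mu Rm, primal_optimal eps C g f M mu Rm /\
    primal_objective eps C g f M mu Rm = dual_value eps C g f + c%:E.
Proof.
move=> hd.
have dvE lam Lam : dual_function eps C g f lam Lam <= dual_value eps C g f + c%:E.
  by rewrite dual_functionE leeD2r//; apply: ereal_sup_ubound; exists lam, Lam.
have [lam0 [Lam0 d0]] := dual_function_proper eps_gt0 C_gtNy g_pcl f_pcl.
have dvd : dual_value eps C g f + c%:E <= d%:E.
  rewrite -leeBrDr//; apply/ereal_supP => _ [lam [Lam ->]].
  by rewrite leeBrDr// -dual_functionE.
have [r hr] : exists r, dual_value eps C g f + c%:E = r%:E.
  have := lt_le_trans d0 (dvE _ _); move: dvd.
  by case: (dual_value _ _ _ _ + _) => [r| |] //; exists r.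
have [|M [mu [Rm [Mf Mo]]]] :=
  primal_point_of_dual_bound (d := r) eps_gt0 C_gtNy g_pcl f_pcl.
  by move=> lam Lam; rewrite -hr.
have dv_le M' mu' Rm' : primal_feasible M' mu' Rm' ->
    dual_value eps C g f + c%:E <= primal_objective eps C g f M' mu' Rm'.
  move=> M'f; rewrite -leeBrDr//; apply/ereal_supP => _ [lam [Lam ->]].
  by rewrite leeBrDr// -dual_functionE; exact: dual_le_primal.
exists M, mu, Rm; split.
  split => //; first exact: le_lt_trans Mo (ltry r).
  by move=> M' mu' Rm' M'f; apply: le_trans Mo _; rewrite -hr; exact: dv_le.
by apply/eqP; rewrite eq_le dv_le// andbT hr.
Qed.

(** With zero gap, M minimises the Lagrangian at these multipliers. Replacing M by [Ms] changes only
    the block [ent]; the other blocks are finite and cancel, so M attains the minimum of [ent]. *)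
Lemma primal_dual_optimal_eq lam Lam M mu Rm :
  primal_optimal eps C g f M mu Rm ->
  primal_objective eps C g f M mu Rm = dual_function eps C g f lam Lam ->
  M = tensor_mul (kernel_tensor eps C) (scaling_tensor eps lam Lam).
Proof.
move=> [Mf My _] Md; have [M0 _ _] := Mf; apply: ent_eq.
have : lagrangian eps C g f M mu Rm lam Lam
    <= lagrangian eps C g f (Ms lam Lam) mu Rm lam Lam.
  rewrite (lagrangian_feasible lam Lam Mf) Md; apply: ereal_inf_lbound.
  by exists (Ms lam Lam), mu, Rm.
have Ly : lagrangian eps C g f M mu Rm lam Lam < +oo by rewrite lagrangian_feasible.
have LN := esum_gtNy (index_enum _) (fun t => gt_gtNy lam t (mu t)).
have LN' := esum_gtNy (index_enum _) (fun e => fe_gtNy Lam e (Rm e)).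
have LN'' := lt_le_trans (ltNyr _) (ent_ge lam Lam M).
move: Ly; rewrite !lagrangian_separable// ent_Ms; move: LN LN' LN''.
case: (ent _ _) => [a| |] //; case: (\sum_t _) => [b| |] //;
  case: (\sum_e _) => [v| |] // _ _ _ _.
by rewrite -!EFinD !lee_fin !lerD2r.
Qed.

End dual.

Theorem theorem3p6 (R : realType) (T N : nat) (E : {set 'I_T * 'I_T})
    (eps : R) (Cm : edge E -> 'M[\bar R]_N)
    (g : 'I_T -> 'cV[R]_N -> \bar R) (f : edge E -> 'M[R]_N -> \bar R)
    (T_gt0 : (0 < T)%N) (connE : graph_connected E) (N_gt0 : (0 < N)%N)
    (eps_gt0 : (0 < eps)%R)
    (C_gtNoo : forall i, -oo < cost_tensor Cm i)
    (g_pcl : forall t, proper_convex_lsc (g t))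
    (f_pcl : forall e, proper_convex_lsc (f e)) :
  let C := cost_tensor Cm in
  exists c : R,
    [/\ forall (lam : 'I_T -> 'cV[R]_N) (Lam : edge E -> 'M[R]_N),
          dual_function eps C g f lam Lam
          = dual_objective eps C g f lam Lam + c%:E,
        (exists M : tensor T N R,
           [/\ nonneg_tensor M, cost C M < +oo,
               forall t, g t (marginal t M) < +oo &
               forall e, f e (bimarginal e M) < +oo]) ->
        exists (M : tensor T N R) (mu : 'I_T -> 'cV[R]_N)
               (Rm : edge E -> 'M[R]_N),
          primal_optimal eps C g f M mu Rm /\
          primal_objective eps C g f M mu Rm
          = dual_value eps C g f + c%:E &
        forall (lam : 'I_T -> 'cV[R]_N) (Lam : edge E -> 'M[R]_N),
          dual_optimal eps C g f lam Lam ->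
          let Mstar :=
            tensor_mul (kernel_tensor eps C) (scaling_tensor eps lam Lam) in
          (exists (mu : 'I_T -> 'cV[R]_N) (Rm : edge E -> 'M[R]_N),
             primal_optimal eps C g f Mstar mu Rm) /\
          (forall (M : tensor T N R) (mu : 'I_T -> 'cV[R]_N)
                  (Rm : edge E -> 'M[R]_N),
             primal_optimal eps C g f M mu Rm -> M = Mstar)].
Proof.
move=> C; exists (\sum_(i : multi_index T N) eps)%R; split.
- by move=> lam Lam; exact: dual_functionE.
- move=> [M [M0 CM gM fM]].
  have Mf : @primal_feasible R T N E M (marginal^~ M) (bimarginal^~ M) by split.
  (* The given tensor with its own marginals is feasible with objective below [+oo], and by weak
     duality it bounds the dual. *)
  have [d hd] : exists d : R,
      primal_objective eps C g f M (marginal^~ M) (bimarginal^~ M) <= d%:E.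
    have : primal_objective eps C g f M (marginal^~ M) (bimarginal^~ M) < +oo.
      apply: lte_add_pinfty; last exact: lte_sum_pinfty.
      apply: lte_add_pinfty; last exact: lte_sum_pinfty.
      by apply: lte_add_pinfty => //; exact: ltry.
    by case: (primal_objective _ _ _ _ _ _ _) => [d| |] //; [exists d|exists 0%R; exact: leNye].
  apply: (primal_optimal_of_dual_bound eps_gt0 C_gtNoo g_pcl f_pcl (d := d)).
  by move=> lam Lam; exact: le_trans (dual_le_primal _ _ _ _ _ _ Mf) hd.
- move=> lam Lam dopt Mstar.
  have dmax lam' Lam' : dual_function eps C g f lam' Lam'
      <= dual_function eps C g f lam Lam.
    by rewrite !dual_functionE// leeD2r.
  (* The maximal dual value is real, so the dual maximiser itself supplies the bound that yields a
     primal optimum. *)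
  have [d dE] : exists d, dual_function eps C g f lam Lam = d%:E.
    have [lam0 [Lam0 d0]] := dual_function_proper eps_gt0 C_gtNoo g_pcl f_pcl.
    have := dual_function_lty eps_gt0 C_gtNoo g_pcl f_pcl lam Lam.
    have := lt_le_trans d0 (dmax _ _).
    by case: (dual_function _ _ _ _ _ _) => [d| |] //; exists d.
  have [|M [mu [Rm [Mopt Mval]]]] :=
    primal_optimal_of_dual_bound (d := d) eps_gt0 C_gtNoo g_pcl f_pcl.
    by move=> lam' Lam'; rewrite -dE.
  have valE : primal_objective eps C g f M mu Rm = dual_function eps C g f lam Lam.
    rewrite Mval dual_functionE//; congr (_ + _); apply/eqP; rewrite eq_le; apply/andP; split.
      by apply/ereal_supP => _ [lam' [Lam' ->]].
    by apply: ereal_sup_ubound; exists lam, Lam.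
  (* All primal optima share one objective value, so each has zero gap with the dual maximiser. *)
  have uniq M' mu' Rm' : primal_optimal eps C g f M' mu' Rm' -> M' = Mstar.
    move=> opt'; apply: (primal_dual_optimal_eq eps_gt0 C_gtNoo g_pcl f_pcl opt' _).
    rewrite -valE; apply/eqP; rewrite eq_le.
    by case: (opt') (Mopt) => [f1 _ m1] [f2 _ m2]; rewrite m1// m2.
  split => //; exists mu, Rm.
  by rewrite -(uniq _ _ _ Mopt).
Qed.
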